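(* Fix an integer $\ell\ge 2$. There are constants $c>0$ and $C>0$ (depending only on $\ell$) such that if an $n$-vertex graph $G$ is $\varepsilon$-far from being triangle-free, where $\varepsilon> C\,n^{-1/(3\ell)}$, then $G$ has at least $c\,\varepsilon^{3\ell}n^{2\ell+1}$ copies of the cycle $C_{2\ell+1}$.
   Context: Graphs are finite and simple. An $n$-vertex graph $G$ is $\varepsilon$-far from being triangle-free if the minimum number of edges that must be removed from $G$ to make it triangle-free is at least $\varepsilon n^2$. Here $C_{2\ell+1}$ is the usual graph cycle of length $2\ell+1$, and a copy is a (not necessarily induced) subgraph isomorphic to it. *)

(* Defs.v *)
From HB Require Import structures.
From mathcomp Require Import all_boot all_order all_algebra.
Set Implicit Arguments.
Unset Strict Implicit.
Unset Printing Implicit Defensive.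
Import Order.TTheory GRing.Theory Num.Theory.

Record sgraph (T : finType) := SGraph {
  adj :> rel T;
  adj_sym : symmetric adj;
  adj_irr : irreflexive adj }.

Definition edges (T : finType) (G : sgraph T) : {set {set T}} :=
  [set [set x; y] | x in T, y in T & G x y].

Section Deletion.
Variables (T : finType) (G : sgraph T) (D : {set {set T}}).

Definition del_adj : rel T := fun x y => G x y && ([set x; y] \notin D).

Lemma del_adj_sym : symmetric del_adj.
Proof. by move=> x y; rewrite /del_adj adj_sym setUC. Qed.

Lemma del_adj_irr : irreflexive del_adj.
Proof. by move=> x; rewrite /del_adj adj_irr. Qed.

Definition del_edges : sgraph T := SGraph del_adj_sym del_adj_irr.
End Deletion.

Definition triangle_free (T : finType) (G : sgraph T) : bool :=
  [forall x, forall y, forall z, ~~ [&& G x y, G y z & G z x]].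

Definition makes_triangle_free (T : finType) (G : sgraph T)
    (D : {set {set T}}) : bool :=
  (D \subset edges G) && triangle_free (del_edges G D).

Definition triangle_free_dist (T : finType) (G : sgraph T) : nat :=
  #|[arg min_(D < edges G | makes_triangle_free G D) #|D|]|.

(* The default value in [triangle_free_dist] is admissible, so the minimum is
   a genuine one. *)
Lemma makes_triangle_free_edges (T : finType) (G : sgraph T) :
  makes_triangle_free G (edges G).
Proof.
rewrite /makes_triangle_free subxx /=.
apply/forallP=> x; apply/forallP=> y; apply/forallP=> z.
apply/negP=> /and3P[/andP[Gxy /negP eNxy] _ _]; apply: eNxy.
by apply/imset2P; exists x y; rewrite ?inE.
Qed.

Definition far_from_triangle_free (R : numDomainType) (eps : R)
    (T : finType) (G : sgraph T) : Prop :=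
  (eps * #|T|%:R ^+ 2 <= (triangle_free_dist G)%:R)%R.

Section Cycle.
Variable k : nat.

(* [ordS] is the cyclic successor; [i != j] only matters when k = 1. *)
Definition cycle_adj : rel 'I_k :=
  fun i j => (i != j) && ((j == ordS i) || (i == ordS j)).

Lemma cycle_adj_sym : symmetric cycle_adj.
Proof. by move=> i j; rewrite /cycle_adj eq_sym orbC. Qed.

Lemma cycle_adj_irr : irreflexive cycle_adj.
Proof. by move=> i; rewrite /cycle_adj eqxx. Qed.

Definition cycle_graph : sgraph 'I_k := SGraph cycle_adj_sym cycle_adj_irr.
End Cycle.

(* A subgraph of G is given by its vertex set and edge set [(V, E)]; the
   bijection f from the vertices of H onto V is an isomorphism from H to
   [(V, E)]. Copies are thus unlabelled: each subgraph is counted once,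
   whatever the number of isomorphisms onto it. *)
Definition is_copy (S T : finType) (H : sgraph S) (G : sgraph T)
    (K : {set T} * {set {set T}}) : bool :=
  (K.2 \subset edges G) &&
  [exists f : {ffun S -> T},
    [&& injectiveb f, K.1 == f @: [set: S]
      & K.2 == [set f @: (e : {set S}) | e in edges H]]].

Definition copies (S T : finType) (H : sgraph S) (G : sgraph T) :
    {set {set T} * {set {set T}}} :=
  [set K | is_copy H G K].

(* Main.v *)
Require Import Defs.
From mathcomp Require Import all_boot all_order all_algebra.
From mathcomp Require Import reals exp.
From mathcomp Require Import zify ring lra.
Import Order.TTheory GRing.Theory Num.Theory.
Set Implicit Arguments.
Unset Strict Implicit.
Unset Printing Implicit Defensive.

(** Why the theorem holds, for k = 2l + 1.

    A maximal family of pairwise edge-disjoint triangles meets every triangle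
    of G in an edge, so deleting the edges of its members destroys all
    triangles; a graph that is eps-far from triangle-free therefore has a
    family with at least eps n^2 ordered triangles
    ([exists_large_packing]).  Passing to a minimal vertex set X on which the
    ordered triangles are still dense enough, every vertex of X lies in at
    least d ordered triangles inside X, where d is of order eps n
    ([exists_dense_core]).

    Edge-disjointness means that every edge uv of the family has a unique
    third vertex, and this is what makes odd closed walks abundant although
    triangles may be scarce.  Fix z in X, let w x be the number of walks of
    length l - 1 from z to x, W their total, and let f u be the sum of w over
    the neighbours of u, that is, the number of walks of length l.  The closed
    walks of length 2l + 1 at z number the sum of f u * f v over the edges uv,
    since an edge in the middle joins two walks of length l.  The sum of w x
    over the ordered triangles (x, u, v) is at least d W.  An edge xu lies in
    only one triangle of the family, so the triangles with second vertex u
    contribute at most f u to this sum; those in which u or v is low, meaning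
    that f is below d W / (4 |X|) there, contribute at most half of d W.  In the
    other triangles the third vertex x is determined by uv, so there are at
    least d W / (2 max w) edges uv with both f u and f v at least
    d W / (4 |X|).  This gives (d W)^3 / (32 |X|^2 max w) closed walks at z ([closed_walks_at]).
    With W >= d^(l-1) and max w <= n^(l-2), summing over X yields at least
    d^(3l) / (32 n^(l-1)), a number of order eps^(3l) n^(2l+1)
    ([many_closed_walks]).  Only one factor |X| is cancelled by the sum
    over z, and the other is at most n, so it does not matter how small X is.

    A closed walk that repeats a vertex is one of at most k^2 n^(2l), which the
    lower bound on eps makes negligible ([closed_tuples_le_uniq]), and a copy
    of the cycle comes from at most k! closed walks
    ([uniq_cycles_le_copies]). *)

(** * Counting walks *)

Section Walks.
Variables (T : finType) (e : rel T).

Fixpoint walks k (x y : T) : nat :=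
  if k is k'.+1 then \sum_(z | e x z) walks k' z y else (x == y).

Lemma walksS k x y : walks k.+1 x y = \sum_z e x z * walks k z y.
Proof.
rewrite /= big_mkcond; apply: eq_bigr => z _.
by case: (e x z); rewrite ?mul1n ?mul0n.
Qed.

Lemma walksD j k x y : walks (j + k) x y = \sum_z walks j x z * walks k z y.
Proof.
elim: j x => [|j IHj] x.
  rewrite add0n (bigD1 x) //= eqxx mul1n big1 ?addn0 // => z.
  by rewrite eq_sym => /negbTE->; rewrite mul0n.
rewrite addSn walksS; under eq_bigr do rewrite IHj big_distrr.
rewrite exchange_big; apply: eq_bigr => z _.
by rewrite walksS big_distrl /=; apply: eq_bigr => u _; rewrite mulnA.
Qed.

Lemma walks1 x y : walks 1 x y = e x y.
Proof.
rewrite walksS (bigD1 y) //= eqxx muln1 big1 ?addn0 // => z /negbTE->.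
by rewrite muln0.
Qed.

Lemma walks_sym k x y : symmetric e -> walks k x y = walks k y x.
Proof.
move=> e_sym; elim: k x y => [|k IHk] x y; first by rewrite /= eq_sym.
rewrite walksS -[in RHS]addn1 walksD; apply: eq_bigr => z _.
by rewrite walks1 e_sym IHk mulnC.
Qed.

Lemma walks_le k x y : walks k.+1 x y <= #|T| ^ k.
Proof.
elim: k x => [|k IHk] x; first by rewrite walks1 expn0 leq_b1.
rewrite walksS expnS -sum_nat_const; apply: leq_sum => z _.
by case: (e x z); rewrite ?mul1n ?mul0n.
Qed.

(** The edges of [e] lead into [X], so a walk that starts in [X] never leaves
    it and has at least [d] continuations at each step. *)
Lemma sum_walks_ge (X : {set T}) d k x :
    (forall y z, e y z -> z \in X) ->
    (forall y, y \in X -> d <= #|[set z | e y z]|) ->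
  x \in X -> d ^ k <= \sum_y walks k x y.
Proof.
move=> eX dX; elim: k x => [|k IHk] x Xx.
  by rewrite expn0 (bigD1 x) //= eqxx leq_addr.
rewrite exchange_big expnS (leq_trans (leq_mul (dX x Xx) (leqnn _))) //.
rewrite -sum_nat_const (eq_bigl (e x)); last by move=> z; rewrite inE.
by apply: leq_sum => z /eX/IHk.
Qed.

Lemma big_tuple_cons k (F : k.+1.-tuple T -> nat) :
  \sum_(p : k.+1.-tuple T) F p
    = \sum_x \sum_(q : k.-tuple T) F (cons_tuple x q).
Proof.
rewrite pair_big (reindex (fun xq : T * k.-tuple T => cons_tuple xq.1 xq.2)) //=.
exists (fun p => (thead p, behead_tuple p)) => [[x q] _|p _] /=.
  by congr (_, _); apply: val_inj.
by rewrite [RHS]tuple_eta; apply: val_inj.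
Qed.

Lemma walks_paths k x y :
  walks k.+1 x y = \sum_(q : k.-tuple T) path e x (rcons q y).
Proof.
elim: k x => [|k IHk] x.
  rewrite walks1 (bigD1 [tuple]) //= big1 => [|q]; last by rewrite tuple0.
  by rewrite andbT addn0.
rewrite walksS big_tuple_cons; apply: eq_bigr => z _.
by rewrite IHk big_distrr; apply: eq_bigr => q _ /=; case: (e x z); rewrite ?mul1n.
Qed.

(** A closed walk at [x] is cut open at its base point, which becomes the first
    entry of the tuple; the tuples are thus rooted and oriented. *)
Lemma closed_walks_card k :
  \sum_x walks k.+1 x x = #|[set p : k.+1.-tuple T | cycle e p]|.
Proof.
rewrite -sum1_card [RHS]big_mkcond big_tuple_cons; apply: eq_bigr => x _.
rewrite walks_paths; apply: eq_bigr => q _.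
by rewrite inE /=; case: path.
Qed.
End Walks.

Arguments walks : simpl never.

(** * Closed odd walks in a linear triple system *)

Section LinearTriples.

(* [t] stands for the ordered triangles of an edge-disjoint family inside [X];
   [t_uniq] is the edge-disjointness. *)
Variables (T : finType) (t : T -> T -> T -> bool) (X : {set T}) (d : nat).
Hypothesis t_swap : forall x y z, t x y z = t y x z.
Hypothesis t_rot : forall x y z, t x y z = t y z x.
Hypothesis t_uniq : forall x y z z', t x y z -> t x y z' -> z = z'.
Hypothesis tX : forall x y z, t x y z -> x \in X.
Hypothesis t_deg : forall x, x \in X -> d <= #|[set p | t x p.1 p.2]|.

Definition shadow : rel T := fun x y => [exists z, t x y z].

Lemma shadow_sym : symmetric shadow.
Proof. by move=> x y; apply: eq_existsb => z; rewrite t_swap. Qed.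

Lemma shadowX x y : shadow x y -> y \in X.
Proof. by case/existsP=> z; rewrite t_swap; apply: tX. Qed.

(** The only use of edge-disjointness: a pair has at most one third vertex, so
    a sum over third vertices costs a maximum and not a factor [#|T|]. *)
Lemma sum_third_le (w : T -> nat) M x y : (forall z, w z <= M) ->
  \sum_(z | t x y z) w z <= shadow x y * M.
Proof.
move=> wM; have [/existsP[z txyz]|] := boolP (shadow x y).
  rewrite mul1n (bigD1 z) //= big1 ?addn0 // => u /andP[txyu].
  by rewrite (t_uniq txyu txyz) eqxx.
by rewrite negb_exists => /forallP tN; rewrite big_pred0 // => z; apply/negbTE.
Qed.

Lemma shadow_deg x : x \in X -> d <= #|[set y | shadow x y]|.
Proof.
move=> /t_deg/leq_trans-> //.
rewrite -sum1_card (eq_bigl (fun p => t x p.1 p.2)); last by move=> p; rewrite inE.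
rewrite -(pair_big_dep xpredT (t x) (fun _ _ => 1)) /= -sum1_card [leqRHS]big_mkcond.
apply: leq_sum => y _; rewrite inE.
by have := @sum_third_le (fun=> 1) 1 x y (fun=> leqnn _); rewrite muln1; case: shadow.
Qed.

(** The number of steps [l.+2] is the [l] of the theorem, so the walks in
    [w] have length [l.+1] and at most [#|T| ^ l] of them share both ends. *)
Lemma closed_walks_at l z : z \in X ->
  (d ^ l.+2) ^ 3 <= 32 * #|X| ^ 2 * #|T| ^ l * walks shadow (2 * l.+2 + 1) z z.
Proof.
move=> Xz; set M := #|T| ^ l.
pose w := walks shadow l.+1 z; pose f := walks shadow l.+2 z.
pose W := \sum_x w x; set S := walks _ _ z z.
have wM x : w x <= M by apply: walks_le.
have dW : d ^ l.+2 <= d * W.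
  by rewrite expnS leq_mul2l (sum_walks_ge _ _ shadow_deg) ?orbT //; apply: shadowX.
have fE u : f u = \sum_x shadow u x * w x.
  rewrite /f walks_sym; last exact: shadow_sym.
  by rewrite walksS; apply: eq_bigr => x _; rewrite walks_sym //; apply: shadow_sym.
have SE : S = \sum_u \sum_v f u * shadow u v * f v.
  rewrite /S (_ : 2 * l.+2 + 1 = l.+2 + (1 + l.+2)); last by lia.
  rewrite walksD; apply: eq_bigr => u _; rewrite (walksD _ 1) big_distrr.
  apply: eq_bigr => v _; rewrite walks1 [LHS]/= mulnA; congr (_ * _).
  by rewrite walks_sym //; apply: shadow_sym.
pose D := d * W; pose n := #|X|.
have n_gt0 : 0 < n by apply/card_gt0P; exists z.
(* With this threshold the sum of [f] over all low vertices is at most [D / 4],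
   which bounds what a low vertex at either end of an edge can spoil. *)
pose low u := 4 * n * f u < D.
pose s u v := \sum_(x | t u v x) w x.
have sE u v : s u v = \sum_x t u v x * w x.
  by rewrite /s big_mkcond; apply: eq_bigr => x _; case: t; rewrite ?mul1n.
(* Both sides weigh the triples [(x, u, v)] by [w x]. *)
have D_le : D <= \sum_u \sum_v s u v.
  under [leqRHS]eq_bigr => u _.
    under eq_bigr do rewrite sE.
    rewrite exchange_big /=; over.
  rewrite exchange_big /= /D /W big_distrr; apply: leq_sum => x _.
  have [Xx|XNx] := boolP (x \in X); last first.
    suff ->: w x = 0 by rewrite [leqLHS]muln0.
    rewrite /w -addn1 walksD big1 // => u _; rewrite walks1.
    by case: (boolP (shadow u x)) => [/shadowX|]; rewrite ?muln0 // (negbTE XNx).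
  under eq_bigr do rewrite -big_distrl /=.
  rewrite -big_distrl leq_mul2r; apply/orP; right.
  apply: leq_trans (t_deg Xx) _; rewrite -sum1_card big_mkcond pair_big.
  by apply/eq_leq/eq_bigr=> -[u v] _; rewrite inE /= (t_rot x); case: t.
have sum_s u : \sum_v s u v <= f u.
  rewrite fE; under eq_bigr do rewrite sE.
  rewrite exchange_big; apply: leq_sum => x _.
  apply: leq_trans (sum_third_le u x (fun=> leqnn (w x))).
  apply/eq_leq; rewrite [RHS]big_mkcond; apply: eq_bigr => v _ /=.
  by rewrite -t_rot t_swap; case: t; rewrite ?mul1n.
have f0 u : u \notin X -> f u = 0.
  move=> uNX; rewrite fE big1 // => x _; rewrite shadow_sym.
  by case: (boolP (shadow x u)) => // /shadowX; rewrite (negbTE uNX).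
have low_le : 4 * (\sum_(u | low u) \sum_v s u v) <= D.
  apply: leq_trans (_ : 4 * (\sum_(u | low u) f u) <= _).
    by rewrite leq_mul2l; apply: leq_sum.
  rewrite -(leq_pmul2l n_gt0) mulnA [n * 4]mulnC big_distrr -sum_nat_const /=.
  rewrite [leqLHS]big_mkcond [leqRHS]big_mkcond; apply: leq_sum => u _.
  have [Xu|/f0->] := boolP (u \in X); last by rewrite muln0 if_same.
  by case: (boolP (low u)) => // /ltnW.
have sC u v : s u v = s v u by apply: eq_bigl => x; rewrite t_swap.
pose H := \sum_(u | ~~ low u) \sum_(v | ~~ low v) shadow u v.
have D_leH : D <= 2 * M * H.
  have high_le : \sum_(u | ~~ low u) \sum_(v | ~~ low v) s u v <= M * H.
    rewrite /H big_distrr; apply: leq_sum => u _; rewrite big_distrr.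
    by apply: leq_sum => v _; rewrite [leqRHS]mulnC; apply: sum_third_le.
  have mixed_le : \sum_(u | ~~ low u) \sum_(v | low v) s u v
                    <= \sum_(u | low u) \sum_v s u v.
    rewrite exchange_big; apply: leq_sum => v _ /=.
    rewrite big_mkcond; apply: leq_sum => u _; rewrite sC.
    by case: ifP.
  move: D_le; rewrite (bigID low) /=.
  rewrite [X in _ + X](eq_bigr (fun u => \sum_(v | low v) s u v
                                   + \sum_(v | ~~ low v) s u v)); last first.
    by move=> u _; rewrite (bigID low).
  rewrite big_split /=; lia.
have H_le : H * D ^ 2 <= 16 * n ^ 2 * S.
  rewrite SE [leqRHS]big_distrr /H big_distrl /= [leqLHS]big_mkcond.
  apply: leq_sum => u _; case: ifP => // hu.
  rewrite big_distrl big_distrr /= big_mkcond; apply: leq_sum => v _.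
  case: ifP => // hv; case: shadow; last by rewrite mul0n.
  move: hu hv; rewrite /low -!leqNgt mul1n muln1 => hu hv.
  have := leq_mul hu hv; nia.
apply: leq_trans (_ : D ^ 3 <= _); first by rewrite leq_exp2r.
rewrite expnS; apply: leq_trans (leq_mul D_leH (leqnn _)) _.
rewrite -mulnA; apply: leq_trans (leq_mul (leqnn _) H_le) _.
by apply/eq_leq; rewrite -/n; ring.
Qed.

(** Of the factor [#|X| ^ 2] in the bound at one vertex, the sum over the
    vertices of [X] cancels one half and [#|X| <= #|T|] absorbs the other. *)
Lemma many_closed_walks l : X != set0 ->
  d ^ (3 * l.+2) <= 32 * #|T| ^ l.+1 * \sum_z walks shadow (2 * l.+2 + 1) z z.
Proof.
move=> X_neq0; have n_gt0 : 0 < #|X| by rewrite card_gt0.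
rewrite -(leq_pmul2l n_gt0) [3 * _]mulnC expnM -sum_nat_const.
apply: (@leq_trans (\sum_(z in X) 32 * #|X| ^ 2 * #|T| ^ l
                                 * walks shadow (2 * l.+2 + 1) z z)).
  by apply: leq_sum => z Xz; apply: closed_walks_at.
rewrite -big_distrr /=.
have sumX : \sum_(z in X) walks shadow (2 * l.+2 + 1) z z
              <= \sum_z walks shadow (2 * l.+2 + 1) z z.
  by rewrite big_mkcond; apply: leq_sum => z _; case: ifP.
apply: leq_trans (leq_mul (leqnn _) sumX) _; rewrite [leqRHS]mulnA leq_mul2r.
rewrite [#|T| ^ l.+1]expnS; apply/orP; right.
rewrite [leqLHS](_ : _ = #|X| * 32 * #|T| ^ l * #|X|); last by ring.
rewrite [leqRHS](_ : _ = #|X| * 32 * #|T| ^ l * #|T|); last by ring.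
by rewrite leq_mul2l max_card orbT.
Qed.
End LinearTriples.

(** * Edge-disjoint triangles *)

Section TrianglePacking.
Variables (T : finType) (G : sgraph T).

(** Two triangles have a common edge exactly when they have two common
    vertices. *)
Definition triangle_packing (F : {set {set T}}) : bool :=
  [forall A in F, (#|A| == 3)
     && [forall x in A, forall y in A, (x != y) ==> G x y]]
  && [forall A in F, forall B in F, (1 < #|A :&: B|) ==> (A == B)].

Lemma triangle_packingP (F : {set {set T}}) :
  reflect [/\ forall A, A \in F -> #|A| = 3,
              forall A x y, A \in F -> x \in A -> y \in A -> x != y -> G x y
            & forall A B x y, A \in F -> B \in F -> x != y ->
                [/\ x \in A, y \in A, x \in B & y \in B] -> A = B]
          (triangle_packing F).
Proof.
apply: (iffP andP) => [[/forall_inP F3 /forall_inP F2]|[F3 FG F2]].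
  split=> [A /F3/andP[/eqP]//|A x y|A B x y].
    by move=> /F3/andP[_ /forall_inP FG] /FG/forall_inP FGx /FGx/implyP.
  move=> /F2/forall_inP FA /FA/implyP AB xy [xA yA xB yB].
  apply/eqP/AB/card_gt1P; exists x, y.
  by rewrite !inE xA yA xB yB.
split; apply/forall_inP => A FA.
  rewrite F3 //=; apply/forall_inP => x xA; apply/forall_inP => y yA.
  by apply/implyP; apply: FG FA xA yA.
apply/forall_inP => B FB; apply/implyP=> /card_gt1P[x [y [xAB yAB xy]]].
move: xAB yAB; rewrite !inE => /andP[xA xB] /andP[yA yB].
by apply/eqP; apply: F2 xy _.
Qed.

Definition in_triangle (F : {set {set T}}) x y z : bool :=
  [&& x != y, y != z, z != x & x |: [set y; z] \in F].

Lemma in_triangle_swap F x y z : in_triangle F x y z = in_triangle F y x z.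
Proof.
rewrite /in_triangle setUCA [y == x]eq_sym [x == z]eq_sym [z == y]eq_sym.
by case: (z == x); rewrite ?andbF.
Qed.

Lemma in_triangle_rot F x y z : in_triangle F x y z = in_triangle F y z x.
Proof.
rewrite /in_triangle [x |: _]setUC.
by rewrite -!setUA; case: (x == y); rewrite ?andbF.
Qed.

Lemma in_triangle_uniq F x y z z' : triangle_packing F ->
  in_triangle F x y z -> in_triangle F x y z' -> z = z'.
Proof.
move=> /triangle_packingP[_ _ F2] /and4P[xy yz zx Fz] /and4P[_ yz' zx' Fz'].
have E : x |: [set y; z] = x |: [set y; z'].
  by apply: F2 xy _ => //; rewrite !inE !eqxx !orbT.
have: z \in x |: [set y; z'] by rewrite -E !inE eqxx !orbT.
by rewrite !inE (negbTE zx) [z == y]eq_sym (negbTE yz) => /eqP.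
Qed.

Lemma in_triangle_adj F x y z : triangle_packing F -> in_triangle F x y z -> G x y.
Proof.
move=> /triangle_packingP[_ FG _] /and4P[xy _ _ FA].
by apply: FG FA _ _ xy; rewrite !inE eqxx ?orbT.
Qed.

(** Ordered triangles are counted because every edge of a member is the pair of
    first entries of one: the edges to delete are an image of this set. *)
Lemma exists_large_packing : exists2 F, triangle_packing F &
  triangle_free_dist G <= #|[set p : T * T * T | in_triangle F p.1.1 p.1.2 p.2]|.
Proof.
have [|F Fmax _] := @maxset_exists _ triangle_packing set0.
  by apply/triangle_packingP; split=> [A|A x y|A B x y]; rewrite inE.
have Fpack := maxsetp Fmax; exists F => //.
have /triangle_packingP[F3 FG F2] := Fpack.
pose P := [set p : T * T * T | in_triangle F p.1.1 p.1.2 p.2].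
pose D := [set [set p.1.1; p.1.2] | p in P].
have inD A x y : A \in F -> x \in A -> y \in A -> x != y -> [set x; y] \in D.
  move=> FA xA yA xy.
  have xyA : [set x; y] \subset A.
    by apply/subsetP=> u; rewrite !inE => /orP[]/eqP->.
  have /cards1P[z Az] : #|A :\: [set x; y]| == 1.
    by rewrite cardsD (setIidPr xyA) cards2 xy F3.
  have : z \in A :\: [set x; y] by rewrite Az set11.
  rewrite !inE negb_or => /andP[/andP[zx zy] zA].
  apply/imsetP; exists (x, y, z) => //; rewrite inE /in_triangle /= xy zx eq_sym zy /=.
  by rewrite setUA -Az -{1}(setIidPr xyA) setID.
apply: leq_trans (leq_imset_card _ _ : #|D| <= #|P|).
rewrite /triangle_free_dist; case: arg_minnP => [|E _ E_min].
  exact: makes_triangle_free_edges.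
apply: E_min; apply/andP; split.
  apply/subsetP=> _ /imsetP[[[x y] z] + ->]; rewrite inE /= => xyz.
  by apply/imset2P; exists x y; rewrite ?inE //= (in_triangle_adj Fpack xyz).
apply/forallP=> x; apply/forallP=> y; apply/forallP=> z; apply/negP=> /=.
rewrite /del_adj => /and3P[/andP[Gxy Dxy] /andP[Gyz Dyz] /andP[Gzx Dzx]].
have neq u v : G u v -> u != v.
  by move=> Guv; apply: contraTneq Guv => ->; rewrite adj_irr.
(* A triangle that survives the deletion shares no edge with the family, and so
   could be added to it. *)
pose A := [set x; y; z].
have AF B u v : B \in F -> u \in A -> v \in A -> u \in B -> v \in B -> u = v.
  move=> FB uA vA uB vB; apply/eqP; apply: contraT => uv.
  have := inD B u v FB uB vB uv; move: uA vA uv; rewrite !inE.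
  by do 2![case/orP=> [/orP[]|] /eqP->]; 
    rewrite ?eqxx ?(negbTE Dxy, negbTE Dyz, negbTE Dzx) //
            1?setUC ?(negbTE Dxy, negbTE Dyz, negbTE Dzx).
have A3 : #|A| = 3.
  rewrite /A setUC cardsU1 cards2 !inE (negbTE (neq _ _ Gzx)) [z == y]eq_sym.
  by rewrite (negbTE (neq _ _ Gyz)) (neq _ _ Gxy).
have FAN : A \notin F.
  apply/negP=> FA; have := AF A x y FA.
  rewrite !inE !eqxx !orbT => /(_ isT isT isT isT) xy.
  by rewrite xy adj_irr in Gxy.
have [] := maxsetP Fmax => _ /(_ (A |: F)) FA.
suff: A |: F = F by move=> AUF; rewrite -AUF setU11 in FAN.
apply: FA; last exact: subsetUr.
apply/triangle_packingP; split.
- by move=> B /setU1P[->|/F3].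
- move=> B u v /setU1P[->|/FG]; last by apply.
  rewrite !inE => /orP[/orP[]|] /eqP-> /orP[/orP[]|] /eqP->; rewrite ?eqxx //= => _ //;
  by rewrite adj_sym.
- move=> B C u v /setU1P[->|FB] /setU1P[->|FC] uv [uB vB uC vC] //.
  + by rewrite (AF C u v) ?eqxx // in uv.
  + by rewrite (AF B u v) ?eqxx // in uv.
  + exact: F2 FB FC uv _.
Qed.
End TrianglePacking.

(** * A vertex set on which all triple degrees are large *)

Section DenseCore.
Variables (T : finType) (t : T -> T -> T -> bool).
Hypothesis t_swap : forall x y z, t x y z = t y x z.
Hypothesis t_rot : forall x y z, t x y z = t y z x.

Definition restrict (X : {set T}) x y z : bool :=
  [&& t x y z, x \in X, y \in X & z \in X].

(** A triple of [X] that is lost with [v] has [v] in one of three places. *)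
Lemma card_restrict_le (X : {set T}) v :
  #|[set p : T * T * T | restrict X p.1.1 p.1.2 p.2]|
    <= #|[set p : T * T * T | restrict (X :\ v) p.1.1 p.1.2 p.2]|
       + 3 * #|[set p : T * T | restrict X v p.1 p.2]|.
Proof.
set A := [set p | _]; set B := [set p | _]; set D := [set p | _].
pose D1 := [set (v, p.1, p.2) | p in D].
pose D2 := [set (p.1, v, p.2) | p in D].
pose D3 := [set (p.1, p.2, v) | p in D].
have AU : A \subset B :|: (D1 :|: (D2 :|: D3)).
  apply/subsetP=> -[[x y] z]; rewrite !inE /restrict /= => /and4P[txyz xX yX zX].
  have [xv|xv] := eqVneq x v.
    have -> : (x, y, z) \in D1; last by rewrite orbT.
    by apply/imsetP; exists (y, z); rewrite ?xv // inE /restrict /= -xv; apply/and4P.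
  have [yv|yv] := eqVneq y v.
    have -> : (x, y, z) \in D2; last by rewrite !orbT.
    apply/imsetP; exists (x, z); rewrite ?yv // inE /restrict /= -yv t_swap.
    by apply/and4P.
  have [zv|zv] := eqVneq z v.
    have -> : (x, y, z) \in D3; last by rewrite !orbT.
    apply/imsetP; exists (x, y); rewrite ?zv // inE /restrict /= -zv t_rot.
    by apply/and4P.
  by rewrite !inE txyz xv xX yv yX zv zX.
have cardU (E F : {set T * T * T}) : #|E :|: F| <= #|E| + #|F|.
  by rewrite leq_card_setU.
apply: leq_trans (subset_leq_card AU) _.
apply: leq_trans (cardU _ _) _; rewrite leq_add2l.
apply: leq_trans (cardU _ _) _; rewrite !mulSn addn0.
apply: leq_add; first exact: leq_imset_card.
apply: leq_trans (cardU _ _) _.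
by apply: leq_add; apply: leq_imset_card.
Qed.

(** Take [X] minimal with more than [m / (2 #|T|)] triples per vertex.  Removing
    a vertex destroys the property, hence loses more triples than this average. *)
Lemma exists_dense_core m : 0 < m ->
    m <= #|[set p : T * T * T | t p.1.1 p.1.2 p.2]| ->
  exists X : {set T}, exists d,
    [/\ X != set0, m < 6 * #|T| * d &
        forall v, v \in X -> d <= #|[set p : T * T | restrict X v p.1 p.2]|].
Proof.
move=> m_gt0 m_le; pose n := #|T|.
pose tau X := #|[set p : T * T * T | restrict X p.1.1 p.1.2 p.2]|.
pose P (X : {set T}) := m * #|X| < 2 * n * tau X.
have tauT : m <= tau setT.
  apply: leq_trans m_le _; apply/subset_leq_card/subsetP=> p.
  by rewrite !inE /restrict => ->; rewrite !inE.
have n_gt0 : 0 < n.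
  have [[[x _] _] _] : exists p, p \in [set p : T * T * T | t p.1.1 p.1.2 p.2].
    by apply/card_gt0P; apply: leq_trans m_gt0 m_le.
  by apply/card_gt0P; exists x.
have PT : P setT by rewrite /P cardsT -/n; nia.
have [X /minsetP[PX Xmin] _] := minset_exists PT.
(* The witness is the least [d] with [m < 6 * n * d]; removing a vertex
   loses up to three triples for each pair that completes it, hence [6] and
   not [2]. *)
exists X; exists (m %/ (6 * n)).+1; split.
- apply: contraTneq PX => ->; rewrite /P /tau (_ : [set p | _] = set0).
    by rewrite !cards0 !muln0.
  by apply/setP=> p; rewrite !inE /restrict !inE; case: t.
- by rewrite mulnC ltn_ceil // muln_gt0.
- move=> v Xv; rewrite ltn_divLR ?muln_gt0 //.
  have := card_restrict_le X v; rewrite -/(tau X) -/(tau (X :\ v)).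
  set D := #|_|.
  have : ~~ P (X :\ v).
    apply/negP=> /Xmin/(_ (subsetDl _ _)) E.
    by move: Xv; rewrite -E !inE eqxx.
  move: PX; rewrite /P -leqNgt (cardsD1 v X) Xv.
  nia.
Qed.
End DenseCore.

(** * From closed walks to copies of the cycle *)

Lemma many_closed_tuples (T : finType) (G : sgraph T) l :
  0 < triangle_free_dist G ->
  exists d, triangle_free_dist G < 6 * #|T| * d /\
    d ^ (3 * l.+2) <= 32 * #|T| ^ l.+1 * #|[set p : (2 * l.+2 + 1).-tuple T | cycle G p]|.
Proof.
move=> dist_gt0; have [F Fpack dist_le] := exists_large_packing G.
have [X [d [X_neq0 dist_lt Xdeg]]] := exists_dense_core (@in_triangle_swap T F)
  (@in_triangle_rot T F) dist_gt0 dist_le.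
exists d; split=> //; pose t := restrict (in_triangle F) X.
have t_swap x y z : t x y z = t y x z.
  by rewrite /t /restrict in_triangle_swap; congr (_ && _); rewrite andbCA.
have t_rot x y z : t x y z = t y z x.
  by rewrite /t /restrict in_triangle_rot; congr (_ && _); rewrite andbC andbA.
have t_uniq x y z z' : t x y z -> t x y z' -> z = z'.
  by move=> /andP[txyz _] /andP[txyz' _]; apply: in_triangle_uniq Fpack txyz txyz'.
have tX x y z : t x y z -> x \in X by case/and4P.
apply: leq_trans (many_closed_walks t_swap t_rot t_uniq tX Xdeg _ X_neq0) _.
rewrite leq_mul2l addn1 closed_walks_card; apply/orP; right.
apply/subset_leq_card/subsetP=> p; rewrite !inE; apply: sub_cycle => x y.
by case/existsP=> z /andP[/(in_triangle_adj Fpack)].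
Qed.

(** At most [k.+1 ^ 2] pairs of positions can collide, and a collision leaves
    [k] free entries. *)
Lemma expn_le_ffact n k : n ^ k.+1 <= n ^_ k.+1 + k.+1 ^ 2 * n ^ k.
Proof.
elim: k => [|k IHk]; first by rewrite expn1 ffactn1 leq_addr.
have ff_le : n ^_ k.+1 <= n ^ k.+1.
  rewrite ffact_prod -[k.+1 in leqRHS]card_ord -prod_nat_const.
  by apply: leq_prod => i _; apply: leq_subr.
rewrite ffactnSr expnS; move: IHk ff_le; rewrite [n ^ k.+1]expnS.
set f := n ^_ _; set a := n ^ k => IHk ff_le.
have n_le : n <= (n - k.+1) + k.+1 by lia.
have := leq_mul (leqnn n) IHk; have := leq_mul (leqnn f) n_le.
have := leq_mul (leqnn k.+1) ff_le.
nia.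
Qed.

Lemma closed_tuples_le_uniq (T : finType) (G : rel T) k :
  #|[set p : k.+1.-tuple T | cycle G p]|
    <= #|[set p : k.+1.-tuple T | cycle G p && uniq p]| + k.+1 ^ 2 * #|T| ^ k.
Proof.
set A := [set p | _]; set B := [set p | _].
pose U := [set p : k.+1.-tuple T | all xpredT p & uniq p].
have cardU : #|U| = #|T| ^_ k.+1 by rewrite /U card_uniq_tuples.
have AU : A \subset B :|: ~: U.
  by apply/subsetP=> p; rewrite !inE => ->; rewrite all_predT /=; case: uniq.
apply: leq_trans (subset_leq_card AU) _.
apply: leq_trans (_ : #|B| + #|~: U| <= _); first by rewrite leq_card_setU.
rewrite leq_add2l -(leq_add2l #|U|) cardsC card_tuple cardU.
exact: expn_le_ffact.
Qed.

Lemma cycle_tnth (T : finType) (G : rel T) k (p : k.-tuple T) (i : 'I_k) :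
  cycle G p -> G (tnth p i) (tnth p (ordS i)).
Proof.
case: k p i => [|k] p i; first by case: i.
case/tupleP: p => x q; set p := [tuple of _] => /(pathP x)/(_ i).
rewrite size_rcons size_tuple => /(_ (ltn_ord i)).
rewrite !(tnth_nth x) /= -rcons_cons nth_rcons /= size_tuple ltn_ord.
rewrite nth_rcons size_tuple => Gi.
case: (ltngtP i k) Gi => [ltik|ltki|->].
- by rewrite modn_small.
- by have := ltn_ord i; lia.
- by rewrite modnn.
Qed.

(** The tuples that give a copy [(V, E)] are among the [k`!] enumerations of
    [V]. *)
Lemma uniq_cycles_le_copies (T : finType) (G : sgraph T) k :
  #|[set p : k.-tuple T | cycle G p && uniq p]|
    <= #|copies (cycle_graph k) G| * k`!.
Proof.
set A := [set p | _].
pose lab (p : k.-tuple T) : {ffun 'I_k -> T} := [ffun i => tnth p i].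
pose copy_of p : {set T} * {set {set T}} :=
  (lab p @: [set: 'I_k],
   [set lab p @: (e : {set 'I_k}) | e in edges (cycle_graph k)]).
have lab_inj p : p \in A -> injective (lab p).
  rewrite inE => /andP[_ /tuple_uniqP p_inj] i j; rewrite !ffunE; exact: p_inj.
have subA p : p \in A -> copy_of p \in copies (cycle_graph k) G.
  move=> Ap; rewrite inE; apply/andP; split; last first.
    by apply/existsP; exists (lab p); rewrite !eqxx !andbT; apply/injectiveP/lab_inj.
  apply/subsetP=> _ /imsetP[_ /imset2P[i j _ + ->] ->].
  rewrite inE => /andP[_ /andP[_ ij]].
  rewrite imsetU1 imset_set1; apply/imset2P; exists (lab p i) (lab p j) => //.
  rewrite !inE /= !ffunE; move: Ap; rewrite inE => /andP[Gp _].
  case/orP: ij => /eqP->; first exact: cycle_tnth.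
  by rewrite adj_sym; apply: cycle_tnth.
rewrite -sum1_card (partition_big copy_of (mem (copies (cycle_graph k) G))) //=.
rewrite -sum_nat_const; apply: leq_sum => K _; rewrite sum1_card.
have [p /andP[Ap /eqP pK]|none] :=
  pickP (fun p => (p \in A) && (copy_of p == K)); last first.
  by rewrite (eq_card0 none).
have cardK : #|K.1| = k.
  by rewrite -pK card_imset ?cardsT ?card_ord //; apply: lab_inj.
have <- : #|[set q : k.-tuple T | all (mem K.1) q & uniq q]| = k`!.
  by rewrite card_uniq_tuples cardK ffactnn.
apply/subset_leq_card/subsetP=> q /andP[Aq /eqP qK].
rewrite inE; move: (Aq); rewrite inE => /andP[_ ->]; rewrite andbT.
apply/allP=> _ /tnthP[i ->]; rewrite -qK /=.
by apply/imsetP; exists i; rewrite ?inE ?ffunE.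
Qed.

(** * The theorem *)

Local Open Scope ring_scope.

Theorem theorem1p3 (R : realType) (l : nat) (hl : (2 <= l)%N) :
  exists c C : R, [/\ 0 < c, 0 < C &
    forall (n : nat) (T : finType) (G : sgraph T) (eps : R),
      #|T| = n ->
      C * n%:R `^ (- (1 / (3 * l)%:R)) < eps ->
      far_from_triangle_free eps G ->
      c * eps ^+ (3 * l) * n%:R ^+ (2 * l + 1)
        <= #|copies (cycle_graph (2 * l + 1)) G|%:R].
Proof.
pose k := (2 * l + 1)%N; pose a := (3 * l)%N.
have [K K_def] : exists K : R, K = 32 * 6 ^+ a by exists (32 * 6 ^+ a).
have K_ge1 : 1 <= K.
  by rewrite K_def -[1]mulr1; apply: ler_pM => //; [lra | apply: exprn_ege1; lra].
have K_gt0 : 0 < K by apply: lt_le_trans K_ge1.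
have [C C_def] : exists C : R, C = 2 * K * (k ^ 2)%:R by exists (2 * K * (k ^ 2)%:R).
have k2_ge1 : 1 <= (k ^ 2)%:R :> R by rewrite ler1n expn_gt0 /k addn1.
have C_ge1 : 1 <= C by rewrite C_def; nra.
have C_gt0 : 0 < C by apply: lt_le_trans C_ge1.
have fact_k : 0 < (k`!)%:R :> R by rewrite ltr0n fact_gt0.
exists (2 * K * (k`!)%:R)^-1, C; split=> //; first by rewrite invr_gt0 !mulr_gt0.
move=> n T G eps Tn Ceps far.
have eps_gt0 : 0 < eps.
  by apply: le_lt_trans Ceps; rewrite mulr_ge0 ?powR_ge0 // ltW.
have [n0|n_gt0] := posnP n.
  by rewrite n0 addn1 expr0n mulr0.
have nR_gt0 : 0 < n%:R :> R by rewrite ltr0n.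
have a_gt0 : (0 < a)%N by rewrite /a; lia.
(* [C >= 1] allows replacing [C ^+ a] by [C]. *)
have C_le : C <= eps ^+ a * n%:R.
  have root_n : (n%:R `^ (- (1 / a%:R))) ^+ a = n%:R^-1 :> R.
    rewrite -powR_mulrn ?powR_ge0 // -powRrM mulNr div1r mulVf ?pnatr_eq0 -?lt0n //.
    by rewrite powR_inv1 // ltW.
  have : (C * n%:R `^ (- (1 / a%:R))) ^+ a <= eps ^+ a.
    by rewrite lerXn2r ?nnegrE ?mulr_ge0 ?powR_ge0 ?(ltW C_gt0) ?(ltW eps_gt0) ?ltW.
  rewrite exprMn root_n ler_pdivrMr //; apply: le_trans.
  by rewrite -[leLHS]expr1 ler_weXn2l.
move: far; rewrite /far_from_triangle_free Tn => far.
have dist_gt0 : (0 < triangle_free_dist G)%N.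
  by rewrite -(ltr0n R); apply: lt_le_trans far; rewrite mulr_gt0 ?exprn_gt0.
have l_eq : l = (l - 2).+2 by lia.
have := @many_closed_tuples T G (l - 2) dist_gt0; rewrite -l_eq -/a Tn.
rewrite (_ : (l - 2).+1 = l.-1); last by lia.
move=> [d [dist_lt]]; rewrite -/k => closed_ge.
have k_eq : k = (2 * l).+1 by rewrite /k addn1.
pose N := #|[set p : k.-tuple T | cycle G p]|.
pose M := #|copies (cycle_graph k) G|.
have N_le : (N <= M * k`! + k ^ 2 * n ^ (2 * l))%N.
  apply: leq_trans (_ : #|[set p : k.-tuple T | cycle G p && uniq p]|
                          + k ^ 2 * n ^ (2 * l) <= _)%N.
    by rewrite /N k_eq -Tn; apply: closed_tuples_le_uniq.
  by rewrite leq_add2r; apply: uniq_cycles_le_copies.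
have epsn_lt : eps * n%:R <= 6 * d%:R.
  rewrite -(ler_pM2r nR_gt0).
  have : eps * n%:R ^+ 2 <= (6 * n * d)%:R by apply: le_trans far _; rewrite ler_nat ltnW.
  by rewrite !natrM; lra.
pose x := eps ^+ a * n%:R ^+ k.
have x_le : x <= K * N%:R.
  have nl_gt0 : 0 < n%:R ^+ l.-1 :> R by rewrite exprn_gt0.
  rewrite -(ler_pM2r nl_gt0) /x -mulrA -exprD.
  rewrite (_ : (k + l.-1 = a)%N); last by rewrite /k /a; lia.
  rewrite -exprMn; apply: le_trans (_ : (6 * d%:R) ^+ a <= _).
    by rewrite lerXn2r ?nnegrE ?mulr_ge0 // ltW.
  have : (d ^ a)%:R <= (32 * n ^ l.-1 * N)%:R :> R by rewrite ler_nat.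
  rewrite exprMn !natrM !natrX => dle.
  have p6 : 0 < 6 ^+ a :> R by rewrite exprn_gt0.
  have := ler_wpM2l (ltW p6) dle; congr (_ <= _); rewrite K_def; ring.
(* This is what [C] was chosen for: the degenerate walks cost half of [x]. *)
have degenerate_le : 2 * K * ((k ^ 2)%:R * n%:R ^+ (2 * l)) <= x.
  have pow_ge0 : 0 <= n%:R ^+ (2 * l) :> R by rewrite exprn_ge0.
  have := ler_wpM2r pow_ge0 C_le; rewrite C_def -[_ * n%:R * _]mulrA -exprS -k_eq.
  by rewrite -[_ * (k ^ 2)%:R * _]mulrA.
have N_le_R : N%:R <= M%:R * (k`!)%:R + (k ^ 2)%:R * n%:R ^+ (2 * l) :> R.
  by rewrite -natrX -!natrM -natrD ler_nat.
suff : x <= 2 * K * (k`!)%:R * M%:R.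
  rewrite -ler_pdivrMl; last by rewrite !mulr_gt0.
  by rewrite /x mulrA.
have := ler_wpM2l (ltW K_gt0) N_le_R; move: x_le degenerate_le; lra.
Qed.
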